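(* Let $x$ be a real number with $0\leqslant x\leqslant 1$. Then $$(1+\sqrt{x})\left\{1-\frac{1}{2^{2}}\left(\frac{2\sqrt[4]{x}}{1+\sqrt{x}}\right)^{2}-\frac{1^{2}\cdot 3}{2^{2}\cdot 4^{2}}\left(\frac{2\sqrt[4]{x}}{1+\sqrt{x}}\right)^{4}-\frac{1^{2}\cdot 3^{2}\cdot 5}{2^{2}\cdot 4^{2}\cdot 6^{2}}\left(\frac{2\sqrt[4]{x}}{1+\sqrt{x}}\right)^{6}-\cdots\right\}$$ $$=1+\left(\frac{1}{2}\right)^{2}x+\left(\frac{1\cdot 1}{2\cdot 4}\right)^{2}x^{2}+\left(\frac{1\cdot 1\cdot 3}{2\cdot 4\cdot 6}\right)^{2}x^{3}+\left(\frac{1\cdot 1\cdot 3\cdot 5}{2\cdot 4\cdot 6\cdot 8}\right)^{2}x^{4}+\cdots,$$ that is, $$(1+\sqrt{x})\sum_{m=0}^{\infty}\frac{-1}{2m-1}\left\{\frac{1}{4^{m}}\binom{2m}{m}\right\}^{2}\left(\frac{2\sqrt[4]{x}}{1+\sqrt{x}}\right)^{2m}=\sum_{n=0}^{\infty}\left\{\frac{(-1)^{n-1}}{2n-1}\,\frac{1}{4^{n}}\binom{2n}{n}\right\}^{2}x^{n}.$$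
   Context: $\sqrt{x}$ and $\sqrt[4]{x}$ denote the nonnegative real roots. In power series, $t^{0}=1$ for every $t$, including $t=0$. The summation forms give the general terms of the two series written with dots. *)

(* Defs.v *)
From Stdlib Require Import Reals Lra.
From Coquelicot Require Import Coquelicot.
Open Scope R_scope.

Definition root4 (x : R) : R := sqrt (sqrt x).

(* On [0, +oo[, [root4 x] is the nonnegative real fourth root of [x]. *)
Lemma root4_spec (x : R) : 0 <= x -> 0 <= root4 x /\ root4 x ^ 4 = x.
Proof.
intros hx; unfold root4; split; [apply sqrt_pos|].
replace (sqrt (sqrt x) ^ 4) with ((sqrt (sqrt x) ^ 2) ^ 2) by ring.
now rewrite pow2_sqrt, pow2_sqrt by (apply sqrt_pos || exact hx).
Qed.

(* 1 . 3 . 5 ... (2n - 1) *)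
Fixpoint odd_prod (n : nat) : R :=
  match n with
  | O => 1
  | S n' => odd_prod n' * (2 * INR n' + 1)
  end.

(* 2 . 4 . 6 ... (2n) *)
Fixpoint even_prod (n : nat) : R :=
  match n with
  | O => 1
  | S n' => even_prod n' * (2 * INR n' + 2)
  end.

(* [Binomial.C] is the real-valued binomial coefficient; the unqualified [C]
   is Coquelicot's type of complex numbers. *)
Definition central (n : nat) : R := 1 / 4 ^ n * Binomial.C (2 * n) n.

Definition lhs_term (t : R) (m : nat) : R :=
  - 1 / (2 * INR m - 1) * central m ^ 2 * t ^ (2 * m).

(* The exponent n - 1 is an integer, equal to -1 at n = 0. *)
Definition rhs_term (x : R) (n : nat) : R :=
  (powerRZ (- 1) (Z.of_nat n - 1) / (2 * INR n - 1) * central n) ^ 2 * x ^ n.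

(* The terms of the two series written with explicit products, the
   leading 1 being left out: index m stands for the term in t^(2(m+1)), resp.
   x^(m+1). The minus signs of the first series are not included. *)
Definition lhs_tail (t : R) (m : nat) : R :=
  odd_prod m ^ 2 * (2 * INR m + 1) / even_prod (S m) ^ 2 * t ^ (2 * S m).

Definition rhs_tail (x : R) (n : nat) : R :=
  (odd_prod n / even_prod (S n)) ^ 2 * x ^ (S n).

Example lhs_tail_first (t : R) :
  lhs_tail t 0 = 1 / 2 ^ 2 * t ^ 2 /\
  lhs_tail t 1 = 1 ^ 2 * 3 / (2 ^ 2 * 4 ^ 2) * t ^ 4 /\
  lhs_tail t 2 = 1 ^ 2 * 3 ^ 2 * 5 / (2 ^ 2 * 4 ^ 2 * 6 ^ 2) * t ^ 6.
Proof. repeat split; unfold lhs_tail; simpl; field. Qed.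

Example rhs_tail_first (x : R) :
  rhs_tail x 0 = (1 / 2) ^ 2 * x /\
  rhs_tail x 1 = (1 * 1 / (2 * 4)) ^ 2 * x ^ 2 /\
  rhs_tail x 2 = (1 * 1 * 3 / (2 * 4 * 6)) ^ 2 * x ^ 3 /\
  rhs_tail x 3 = (1 * 1 * 3 * 5 / (2 * 4 * 6 * 8)) ^ 2 * x ^ 4.
Proof. repeat split; unfold rhs_tail; simpl; field. Qed.

(* Main.v *)
(* Put k = sqrt x and z = 4k / (1+k)^2, the square of the left-hand variable.
   The left series is the hypergeometric function F(-1/2, 1/2; 1; z), the right
   one F(-1/2, -1/2; 1; k^2).  By the hypergeometric equation, both sides, as
   functions of k, satisfy k (1-k^2) y'' + (1+k^2) y' - k y = 0.  This equation
   is singular at k = 0, so its solutions regular there are proportional; both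
   sides equal 1 at k = 0, whence equality for k < 1.  Abel's theorem gives
   k = 1. *)

Require Import Defs.
From Stdlib Require Import Reals Lra Lia.
From Coquelicot Require Import Coquelicot.
Open Scope R_scope.

(** * Differential equations and power series up to the boundary point 1 *)

(** The coefficient of z^n in the left side is (n+1)^2 a_(n+1) - (n+p)(n+q) a_n, because n(n-1) +
    (p+q+1)n + pq = (n+p)(n+q). *)
Lemma hypergeometric_ode (a : nat -> R) (p q z : R) :
  (forall n, (INR n + 1) ^ 2 * a (S n) = (INR n + p) * (INR n + q) * a n) ->
  Rbar_lt (Rabs z) (CV_radius a) ->
  z * (1 - z) * PSeries (PS_derive (PS_derive a)) z
  + (1 - (p + q + 1) * z) * PSeries (PS_derive a) z
  - p * q * PSeries a z = 0.
Proof.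
intros ha hz.
set (b := PS_derive a); set (c := PS_derive b).
assert (ea : ex_pseries a z) by now apply CV_radius_inside.
assert (eb : ex_pseries b z).
{ apply CV_radius_inside; unfold b; now rewrite CV_radius_derive. }
assert (ec : ex_pseries c z).
{ apply CV_radius_inside; unfold c, b; now rewrite !CV_radius_derive. }
(* The equation is rearranged as z y'' + y' = z^2 y'' + (p+q+1) z y' + p q y, each factor z being an
   index shift. The double shift makes the indices 0 and 1 separate cases. *)
assert (E : PSeries (PS_plus (PS_incr_1 c) b) z =
  PSeries (PS_plus (PS_plus (PS_incr_1 (PS_incr_1 c))
    (PS_scal (p + q + 1) (PS_incr_1 b))) (PS_scal (p * q) a)) z).
{ apply PSeries_ext; intros n.
  generalize (ha n).
  destruct n as [|[|n]]; unfold PS_plus, PS_scal, c, b, PS_derive;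
    simpl PS_incr_1; unfold plus, scal, zero; simpl; unfold mult; simpl.
  - intros h; lra.
  - intros h; lra.
  - rewrite <- ?S_INR.
    change (match n with 0%nat => 1 | S _ => INR n + 1 end) with (INR (S n)).
    rewrite S_INR. intros h; nra. }
rewrite !PSeries_plus, !PSeries_scal, !PSeries_incr_1 in E.
- nra.
- now repeat apply ex_pseries_incr_1.
- apply ex_pseries_scal; [apply Rmult_comm|now apply ex_pseries_incr_1].
- apply ex_pseries_plus; [now repeat apply ex_pseries_incr_1|].
  apply ex_pseries_scal; [apply Rmult_comm|now apply ex_pseries_incr_1].
- apply ex_pseries_scal; [apply Rmult_comm|assumption].
- now apply ex_pseries_incr_1.
- assumption.
Qed.

Lemma radius_ge_1 (a : nat -> R) :
  ex_series (fun n => Rabs (a n)) -> Rbar_le 1 (CV_radius a).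
Proof.
intros ha.
apply (Lub_Rbar_correct (CV_disk a)).
unfold CV_disk; revert ha; apply ex_series_ext; intros n.
now rewrite pow1, Rmult_1_r.
Qed.

(** The radius is at least 1. If it exceeds 1, the point 1 is interior; if it equals 1, this is
    Abel's theorem. *)
Lemma PSeries_left_continuous_1 (a : nat -> R) :
  ex_series (fun n => Rabs (a n)) ->
  filterlim (PSeries a) (at_left 1) (locally (PSeries a 1)).
Proof.
intros ha.
destruct (Rbar_le_lt_or_eq_dec _ _ (radius_ge_1 a ha)) as [h|h].
- apply (filterlim_filter_le_1 (F := locally 1)); [apply filter_le_within|].
  apply continuity_pt_filterlim, PSeries_continuity.
  now rewrite Rabs_R1.
- generalize (Abel a); rewrite <- h; intros A; apply A; simpl; auto; try lra.
  now apply ex_pseries_1, ex_series_Rabs.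
Qed.

(* [k / (1 - k^2)] is the integrating factor of the equation; it vanishes at
   the singular point 0, so the Wronskian of two regular solutions vanishes. *)
Lemma regular_solutions_proportional (f f1 f2 g g1 g2 : R -> R) :
  (forall k, 0 <= k < 1 -> is_derive f k (f1 k)) ->
  (forall k, 0 <= k < 1 -> is_derive f1 k (f2 k)) ->
  (forall k, 0 <= k < 1 -> is_derive g k (g1 k)) ->
  (forall k, 0 <= k < 1 -> is_derive g1 k (g2 k)) ->
  (forall k, 0 <= k < 1 ->
     k * (1 - k ^ 2) * f2 k + (1 + k ^ 2) * f1 k - k * f k = 0) ->
  (forall k, 0 <= k < 1 ->
     k * (1 - k ^ 2) * g2 k + (1 + k ^ 2) * g1 k - k * g k = 0) ->
  (forall k, 0 <= k < 1 -> g k <> 0) ->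
  forall k, 0 <= k < 1 -> f k * g 0 = f 0 * g k.
Proof.
intros df df1 dg dg1 of og ng k hk.
assert (W : forall k, 0 < k < 1 -> f1 k * g k - f k * g1 k = 0).
{ clear k hk; intros k hk.
  set (w := fun k => k / (1 - k ^ 2) * (f1 k * g k - f k * g1 k)).
  assert (E : w 0 = w k).
  { apply eq_is_derive; [|lra]; intros s hs.
    assert (hs' : 0 <= s < 1) by lra.
    assert (s2 : 1 - s ^ 2 <> 0) by nra.
    specialize (df s hs'); specialize (df1 s hs').
    specialize (dg s hs'); specialize (dg1 s hs').
    specialize (of s hs'); specialize (og s hs').
    unfold w; auto_derive.
    - repeat split; try (now eexists; eauto).
      contradict s2; rewrite <- s2; ring.
    - replace (Derive (fun x => f x) s) with (f1 s)
        by (symmetry; now apply is_derive_unique).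
      replace (Derive (fun x => g x) s) with (g1 s)
        by (symmetry; now apply is_derive_unique).
      replace (Derive (fun x => f1 x) s) with (f2 s)
        by (symmetry; now apply is_derive_unique).
      replace (Derive (fun x => g1 x) s) with (g2 s)
        by (symmetry; now apply is_derive_unique).
      unfold zero; simpl.
      (* The derivative of [w] is g times the equation of f minus f times the equation of g, over
         (1-s^2)^2; the terms in s f g cancel. *)
      transitivity ((g s * (s * (1 - s ^ 2) * f2 s + (1 + s ^ 2) * f1 s - s * f s)
        - f s * (s * (1 - s ^ 2) * g2 s + (1 + s ^ 2) * g1 s - s * g s))
        / (1 - s ^ 2) ^ 2).
      + field. repeat split; nra.
      + rewrite of, og; field; nra. }
  unfold w in E; rewrite Rdiv_0_l, Rmult_0_l in E.
  symmetry in E; apply Rmult_integral in E; destruct E as [E|E]; [|exact E].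
  apply Rmult_integral in E; destruct E as [E|E]; [lra|].
  exfalso; revert E; apply Rinv_neq_0_compat; nra. }
assert (W' : forall k, 0 <= k < 1 -> f1 k * g k - f k * g1 k = 0).
{ intros s hs; destruct (Req_dec s 0) as [->|hs0]; [|apply W; lra].
  (* At 0 the equations reduce to [f1 0 = 0] and [g1 0 = 0]. *)
  generalize (of 0 hs) (og 0 hs); intros o1 o2; nra. }
destruct (Req_dec k 0) as [->|hk0]; [ring|].
(* The derivative of f / g is the Wronskian over g^2, hence zero. *)
assert (E : f 0 / g 0 = f k / g k).
{ apply (eq_is_derive (fun s => f s / g s)); [|lra]; intros s hs.
  assert (hs' : 0 <= s < 1) by lra.
  auto_derive.
  - repeat split; try (now eexists; eauto); auto.
  - replace (Derive (fun x => f x) s) with (f1 s)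
      by (symmetry; now apply is_derive_unique, df).
    replace (Derive (fun x => g x) s) with (g1 s)
      by (symmetry; now apply is_derive_unique, dg).
    unfold zero; simpl.
    transitivity ((f1 s * g s - f s * g1 s) / g s ^ 2).
    + field; auto.
    + rewrite W' by auto; field; auto. }
apply (f_equal (fun u => u * (g 0 * g k))) in E.
field_simplify in E; auto. lra.
apply ng; lra.
Qed.

(** * Coefficients of the two series: recurrences and absolute summability *)

Lemma central_0 : central 0 = 1.
Proof. unfold central, Binomial.C; simpl; field. Qed.

Lemma central_S (n : nat) :
  central (S n) = central n * ((2 * INR n + 1) / (2 * INR n + 2)).
Proof.
unfold central, Binomial.C.
replace (2 * S n - S n)%nat with (S n) by lia.
replace (2 * n - n)%nat with n by lia.
replace (2 * S n)%nat with (S (S (2 * n))) by lia.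
rewrite !fact_simpl, !mult_INR, !S_INR, mult_INR; simpl (INR 2); simpl pow.
generalize (pos_INR n) (INR_fact_neq_0 n); intros hn hf.
field; repeat split; try lra; apply pow_nonzero; lra.
Qed.

Lemma even_prod_pos (n : nat) : 0 < even_prod n.
Proof.
induction n as [|n IH]; simpl; [lra|].
generalize (pos_INR n); intros; apply Rmult_lt_0_compat; lra.
Qed.

Lemma central_prod (n : nat) : central n = odd_prod n / even_prod n.
Proof.
induction n as [|n IH]; [rewrite central_0; simpl; field|].
rewrite central_S, IH; simpl.
generalize (pos_INR n) (even_prod_pos n); intros; field; lra.
Qed.

(** The induction step amounts to (2n+1)(2n+3) <= (2n+2)^2, where the two sides differ by 1. *)
Lemma central_sqr_le (n : nat) : central n ^ 2 <= / (2 * INR n + 1).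
Proof.
induction n as [|n IH]; [rewrite central_0; simpl; lra|].
rewrite central_S, S_INR, Rpow_mult_distr.
generalize (pos_INR n); intros hn.
apply Rle_trans with
  (/ (2 * INR n + 1) * ((2 * INR n + 1) / (2 * INR n + 2)) ^ 2).
{ apply Rmult_le_compat_r; [apply pow2_ge_0|exact IH]. }
apply Rminus_le_0.
replace (_ - _) with (/ ((2 * (INR n + 1) + 1) * (2 * INR n + 2) ^ 2))
  by (field; lra).
apply Rlt_le, Rinv_0_lt_compat, Rmult_lt_0_compat; [lra|apply pow_lt; lra].
Qed.

Lemma two_n_minus_1_neq_0 (n : nat) : 2 * INR n - 1 <> 0.
Proof.
destruct n as [|n]; [simpl; lra|].
rewrite S_INR; generalize (pos_INR n); lra.
Qed.

Definition lhs_coef (n : nat) : R := - 1 / (2 * INR n - 1) * central n ^ 2.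

(** The sign in [rhs_term] is omitted because the square removes it. *)
Definition rhs_coef (n : nat) : R := (central n / (2 * INR n - 1)) ^ 2.

Lemma lhs_coef_rec (n : nat) :
  (INR n + 1) ^ 2 * lhs_coef (S n)
  = (INR n + - 1 / 2) * (INR n + 1 / 2) * lhs_coef n.
Proof.
unfold lhs_coef; rewrite central_S, S_INR.
generalize (pos_INR n) (two_n_minus_1_neq_0 n); intros; field; lra.
Qed.

Lemma rhs_coef_rec (n : nat) :
  (INR n + 1) ^ 2 * rhs_coef (S n)
  = (INR n + - 1 / 2) * (INR n + - 1 / 2) * rhs_coef n.
Proof.
unfold rhs_coef; rewrite central_S, S_INR.
generalize (pos_INR n) (two_n_minus_1_neq_0 n); intros; field; lra.
Qed.

(* Telescoping: [1 / (2n+1) - 1 / (2n+3) = 2 / ((2n+1) (2n+3))]. *)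
Lemma ex_series_odd_products :
  ex_series (fun n => / ((2 * INR n + 1) * (2 * INR n + 3))).
Proof.
assert (S1 : forall n, sum_n (fun n => / ((2 * INR n + 1) * (2 * INR n + 3))) n
  = / 2 * (1 - / (2 * INR n + 3))).
{ induction n as [|n IH]; [rewrite sum_O; simpl; field|].
  rewrite sum_Sn, IH, S_INR; unfold plus; simpl.
  generalize (pos_INR n); intros; field; lra. }
apply (ex_finite_lim_seq_incr _ (/ 2)).
- intros n; rewrite sum_Sn.
  enough (0 <= / ((2 * INR (S n) + 1) * (2 * INR (S n) + 3)))
    by (unfold plus; simpl in *; lra).
  generalize (pos_INR (S n)); intros.
  apply Rlt_le, Rinv_0_lt_compat, Rmult_lt_0_compat; lra.
- intros n; rewrite S1.
  assert (0 < / (2 * INR n + 3))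
    by (apply Rinv_0_lt_compat; generalize (pos_INR n); lra).
  lra.
Qed.

(** By [central_sqr_le], the coefficient of index n+1 is at most 1 / ((2n+1)(2n+3)) in absolute
    value. Index 0, where 2n-1 is negative, is split off first. *)
Lemma lhs_coef_abs_summable : ex_series (fun n => Rabs (lhs_coef n)).
Proof.
apply ex_series_incr_1.
apply (@ex_series_le R_AbsRing R_CompleteNormedModule _ _) with
  (2 := ex_series_odd_products).
intros n; unfold norm; simpl; unfold abs; simpl; rewrite Rabs_Rabsolu.
unfold lhs_coef; generalize (central_sqr_le (S n)).
rewrite S_INR; generalize (pos_INR n) (pow2_ge_0 (central (S n))).
intros hn h0 h; rewrite Rabs_mult, (Rabs_pos_eq _ h0), Rabs_left.
- replace (/ _) with
    (- (- 1 / (2 * (INR n + 1) - 1)) * / (2 * (INR n + 1) + 1))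
    by (field; lra).
  apply Rmult_le_compat_l; [|exact h].
  replace (- _) with (/ (2 * INR n + 1)) by (field; lra).
  apply Rlt_le, Rinv_0_lt_compat; lra.
- apply Ropp_lt_cancel; rewrite Ropp_0.
  replace (- _) with (/ (2 * INR n + 1)) by (field; lra).
  apply Rinv_0_lt_compat; lra.
Qed.

(** [rhs_coef n] is [lhs_coef n] times -1 / (2n-1), and |2n-1| >= 1. *)
Lemma rhs_coef_abs_summable : ex_series (fun n => Rabs (rhs_coef n)).
Proof.
apply (@ex_series_le R_AbsRing R_CompleteNormedModule _ _) with
  (2 := lhs_coef_abs_summable).
intros n; unfold norm; simpl; unfold abs; simpl; rewrite Rabs_Rabsolu.
unfold rhs_coef, lhs_coef.
generalize (two_n_minus_1_neq_0 n); intros hn.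
replace ((central n / (2 * INR n - 1)) ^ 2) with
  (- 1 / (2 * INR n - 1) * (- 1 / (2 * INR n - 1) * central n ^ 2))
  by (field; exact hn).
rewrite Rabs_mult.
rewrite <- (Rmult_1_l (Rabs (_ * central n ^ 2))) at 2.
apply Rmult_le_compat_r; [apply Rabs_pos|].
rewrite Rabs_div by exact hn.
replace (Rabs (- 1)) with 1 by (rewrite Rabs_left; lra).
unfold Rdiv; rewrite Rmult_1_l, <- Rinv_1.
apply Rinv_le_contravar; [lra|].
destruct n as [|n]; [simpl; rewrite Rabs_left; lra|].
rewrite S_INR in *; generalize (pos_INR n); intros; rewrite Rabs_pos_eq; lra.
Qed.

(** * The Landen substitution and the identity for k < 1 *)

(** Ascending Landen transformation on squared moduli: the modulus k goes to 2 sqrt k / (1+k), with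
    complementary modulus (1-k) / (1+k). *)
Definition landen (k : R) : R := 4 * k / (1 + k) ^ 2.

Lemma landen_compl (k : R) : 0 <= k -> landen k = 1 - ((1 - k) / (1 + k)) ^ 2.
Proof. intros hk; unfold landen; field; lra. Qed.

Lemma landen_bounds (k : R) : 0 <= k < 1 -> 0 <= landen k < 1.
Proof.
intros hk; split.
- apply Rdiv_le_0_compat; [lra|apply pow_lt; lra].
- rewrite landen_compl by lra.
  assert (0 < ((1 - k) / (1 + k)) ^ 2)
    by (apply pow_lt, Rdiv_lt_0_compat; lra).
  lra.
Qed.

Lemma inside_radius (a : nat -> R) (z : R) :
  ex_series (fun n => Rabs (a n)) -> 0 <= z < 1 ->
  Rbar_lt (Rabs z) (CV_radius a).
Proof.
intros ha hz; rewrite Rabs_pos_eq by lra.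
apply Rbar_lt_le_trans with 1; [simpl; lra|now apply radius_ge_1].
Qed.

Lemma is_derive_landen (k : R) : 0 <= k ->
  is_derive landen k (4 * (1 - k) / (1 + k) ^ 3).
Proof.
intros hk; unfold landen; auto_derive.
- rewrite Rmult_1_r; apply Rmult_integral_contrapositive_currified; lra.
- field; lra.
Qed.

(** This keeps the right-hand series away from 0, so that it can serve as the divisor in
    [regular_solutions_proportional]. *)
Lemma PSeries_ge_first (a : nat -> R) (z : R) :
  (forall n, 0 <= a n) -> 0 <= z -> Rbar_lt (Rabs z) (CV_radius a) ->
  a 0%nat <= PSeries a z.
Proof.
intros ha hz hr.
assert (e : ex_series (fun n => a n * z ^ n))
  by now apply ex_pseries_R, CV_radius_inside.
unfold PSeries; rewrite Series_incr_1 by exact e; simpl pow at 1.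
apply ex_series_incr_1 in e.
(* The zero series is written as 0 times the tail so that [Series_scal_l] evaluates it. *)
assert (h := Series_le (fun n => 0 * (a (S n) * z ^ S n))
  (fun n => a (S n) * z ^ S n)).
rewrite Series_scal_l, Rmult_0_l in h.
enough (0 <= Series (fun k => a (S k) * z ^ S k)) by lra.
apply h; [|exact e].
intros n; rewrite Rmult_0_l.
split; [lra|apply Rmult_le_pos; auto; apply pow_le, hz].
Qed.

Lemma landen_identity_lt_1 (k : R) : 0 <= k < 1 ->
  (1 + k) * PSeries lhs_coef (landen k) = PSeries rhs_coef (k ^ 2).
Proof.
intros hk.
set (a := lhs_coef); set (b := rhs_coef).
assert (ra : forall z, 0 <= z < 1 -> Rbar_lt (Rabs z) (CV_radius a))
  by (intros; now apply inside_radius; [apply lhs_coef_abs_summable|]).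
assert (rb : forall z, 0 <= z < 1 -> Rbar_lt (Rabs z) (CV_radius b))
  by (intros; now apply inside_radius; [apply rhs_coef_abs_summable|]).
assert (sq : forall s, 0 <= s < 1 -> 0 <= s ^ 2 < 1) by (intros; nra).
(* Here and below the indices 1 and 2 count derivatives in the inner variable, [landen s] or
   [s ^ 2]; the chain rule factors come separately. *)
set (P1 := PSeries (PS_derive a)); set (P2 := PSeries (PS_derive (PS_derive a))).
set (Q1 := PSeries (PS_derive b)); set (Q2 := PSeries (PS_derive (PS_derive b))).
set (u := fun s => PSeries a (landen s)).
set (u1 := fun s => P1 (landen s)); set (u2 := fun s => P2 (landen s)).
set (v := fun s => PSeries b (s ^ 2)).
set (v1 := fun s => Q1 (s ^ 2)); set (v2 := fun s => Q2 (s ^ 2)).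
assert (du : forall s, 0 <= s < 1 ->
  is_derive u s (4 * (1 - s) / (1 + s) ^ 3 * u1 s)).
{ intros s hs; apply (is_derive_comp (PSeries a) landen).
  - now apply is_derive_PSeries, ra, landen_bounds.
  - now apply is_derive_landen. }
assert (du1 : forall s, 0 <= s < 1 ->
  is_derive u1 s (4 * (1 - s) / (1 + s) ^ 3 * u2 s)).
{ intros s hs; apply (is_derive_comp P1 landen).
  - apply is_derive_PSeries; rewrite CV_radius_derive; now apply ra, landen_bounds.
  - now apply is_derive_landen. }
assert (dsq : forall s, is_derive (fun s => s ^ 2) s (2 * s))
  by (intros; auto_derive; [exact I|ring]).
assert (dv : forall s, 0 <= s < 1 -> is_derive v s (2 * s * v1 s)).
{ intros s hs; apply (is_derive_comp (PSeries b) (fun s => s ^ 2)); [|apply dsq].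
  now apply is_derive_PSeries, rb, sq. }
assert (dv1 : forall s, 0 <= s < 1 -> is_derive v1 s (2 * s * v2 s)).
{ intros s hs; apply (is_derive_comp Q1 (fun s => s ^ 2)); [|apply dsq].
  apply is_derive_PSeries; rewrite CV_radius_derive; now apply rb, sq. }
assert (ou : forall s, 0 <= s < 1 ->
  landen s * (1 - landen s) * u2 s + (1 - (- 1 / 2 + 1 / 2 + 1) * landen s) * u1 s
  - - 1 / 2 * (1 / 2) * u s = 0).
{ intros s hs; apply hypergeometric_ode;
    [exact lhs_coef_rec|now apply ra, landen_bounds]. }
assert (ov : forall s, 0 <= s < 1 ->
  s ^ 2 * (1 - s ^ 2) * v2 s + (1 - (- 1 / 2 + - 1 / 2 + 1) * s ^ 2) * v1 s
  - - 1 / 2 * (- 1 / 2) * v s = 0).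
{ intros s hs; apply hypergeometric_ode;
    [exact rhs_coef_rec|now apply rb, sq]. }
assert (vpos : forall s, 0 <= s < 1 -> 1 <= v s).
{ intros s hs; replace 1 with (b 0%nat).
  - apply PSeries_ge_first; [intros; apply pow2_ge_0|apply sq, hs|apply rb, sq, hs].
  - unfold b, rhs_coef; rewrite central_0; simpl; field. }
assert (u0 : u 0 = 1).
{ unfold u, landen; rewrite Rmult_0_r, Rdiv_0_l, PSeries_0.
  unfold a, lhs_coef; rewrite central_0; simpl; field. }
assert (v0 : v 0 = 1).
{ unfold v; rewrite pow_i, PSeries_0 by lia.
  unfold b, rhs_coef; rewrite central_0; simpl; field. }
change ((1 + k) * u k = v k).
(* From here on only the derivatives, the two equations, the values at 0 and the lower bound on [v]
   matter. *)
clearbody u u1 u2 v v1 v2.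
assert (E : (1 + k) * u k * v 0 = (1 + 0) * u 0 * v k).
{ apply (regular_solutions_proportional (fun s => (1 + s) * u s)
    (fun s => u s + 4 * (1 - s) / (1 + s) ^ 2 * u1 s)
    (fun s => - 8 / (1 + s) ^ 3 * u1 s + 16 * (1 - s) ^ 2 / (1 + s) ^ 5 * u2 s)
    v
    (fun s => 2 * s * v1 s)
    (fun s => 2 * v1 s + 4 * s ^ 2 * v2 s)); trivial; intros s hs.
  - specialize (du s hs).
    auto_derive; [now eexists; eauto|].
    replace (Derive _ s) with (4 * (1 - s) / (1 + s) ^ 3 * u1 s)
      by (symmetry; now apply is_derive_unique).
    field; lra.
  - specialize (du s hs); specialize (du1 s hs).
    auto_derive.
    + repeat split; try (now eexists; eauto).
      rewrite Rmult_1_r; apply Rmult_integral_contrapositive_currified; lra.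
    + replace (Derive (fun x => u x) s) with (4 * (1 - s) / (1 + s) ^ 3 * u1 s)
        by (symmetry; now apply is_derive_unique).
      replace (Derive (fun x => u1 x) s) with (4 * (1 - s) / (1 + s) ^ 3 * u2 s)
        by (symmetry; now apply is_derive_unique).
      field; lra.
  - specialize (dv1 s hs).
    auto_derive; [now eexists; eauto|].
    replace (Derive _ s) with (2 * s * v2 s)
      by (symmetry; now apply is_derive_unique).
    ring.
  - specialize (ou s hs).
    (* The equation in s for (1+s) u is 4(1-s) times the hypergeometric one at [landen s], by 1 -
       landen s = ((1-s) / (1+s))^2. For v the factor is 4s. *)
    apply (f_equal (Rmult (4 * (1 - s)))) in ou; rewrite Rmult_0_r in ou.
    rewrite <- ou; unfold landen; field; lra.
  - specialize (ov s hs).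
    apply (f_equal (Rmult (4 * s))) in ov; rewrite Rmult_0_r in ov.
    rewrite <- ov; field.
  - specialize (vpos s hs); lra. }
rewrite u0, v0 in E; lra.
Qed.

(** * The endpoint k = 1 *)

Lemma landen_identity (k : R) : 0 <= k <= 1 ->
  (1 + k) * PSeries lhs_coef (landen k) = PSeries rhs_coef (k ^ 2).
Proof.
intros hk; destruct (Req_dec k 1) as [->|hk1];
  [|apply landen_identity_lt_1; lra].
assert (near : at_left 1 (fun s => 0 <= s < 1)).
{ exists (mkposreal 1 Rlt_0_1); intros s hs hs1.
  apply Rabs_lt_between in hs; unfold minus, plus, opp in hs; simpl in hs; lra. }
(* The series are known to be continuous at 1 only from the left, so the inner maps must approach 1
   from below. *)
assert (cont : forall u : R -> R, u 1 = 1 -> continuous u 1 ->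
  (forall s, 0 <= s < 1 -> u s < 1) ->
  filterlim u (at_left 1) (at_left 1)).
{ intros u u1 cu hu p [d hd].
  unfold continuous in cu; rewrite u1 in cu.
  change (at_left 1 (fun s => p (u s))).
  generalize (filter_and _ _ near
    (filter_le_within (F := locally 1) (fun s => s < 1) _ (cu _ (locally_ball 1 d)))).
  apply filter_imp; intros s [hs hs']; apply hd; [exact hs'|now apply hu]. }
assert (F : filterlim (fun s => (1 + s) * PSeries lhs_coef (landen s))
  (at_left 1) (locally ((1 + 1) * PSeries lhs_coef 1))).
{ apply (filterlim_comp_2 (G := locally (1 + 1)) (H := locally (PSeries lhs_coef 1))).
  - apply (filterlim_filter_le_1 (F := locally 1)); [apply filter_le_within|].
    apply (continuous_plus (fun _ => 1) (fun s => s));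
      [apply continuous_const|apply continuous_id].
  - apply (filterlim_comp _ _ _ landen _ _ (at_left 1)).
    + apply cont.
      * unfold landen; field.
      * apply (ex_derive_continuous landen); eexists; apply is_derive_landen; lra.
      * apply landen_bounds.
    + apply PSeries_left_continuous_1, lhs_coef_abs_summable.
  - apply (filterlim_mult (K := R_AbsRing)). }
assert (G : filterlim (fun s => PSeries rhs_coef (s ^ 2))
  (at_left 1) (locally (PSeries rhs_coef 1))).
{ apply (filterlim_comp _ _ _ (fun s => s ^ 2) _ _ (at_left 1)).
  - apply cont; [ring| |intros; nra].
    apply (ex_derive_continuous (fun s => s ^ 2)); auto_derive; exact I.
  - apply PSeries_left_continuous_1, rhs_coef_abs_summable. }
replace (landen 1) with 1 by (unfold landen; field); rewrite pow1.
(* Both sides are left limits at 1 of functions that agree on [0, 1[. *)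
apply (filterlim_locally_unique (F := at_left 1) _ _ _ F).
revert G; apply filterlim_ext_loc; revert near; apply filter_imp.
intros s hs; symmetry; now apply landen_identity_lt_1.
Qed.

(** * Return to the two written forms of the series *)

Lemma ex_series_unit_interval (a : nat -> R) (z : R) :
  ex_series (fun n => Rabs (a n)) -> 0 <= z <= 1 ->
  ex_series (fun n => a n * z ^ n).
Proof.
intros ha hz; apply ex_series_Rabs, (CV_disk_le a z 1).
- rewrite Rabs_R1, Rabs_pos_eq; lra.
- unfold CV_disk; revert ha; apply ex_series_ext; intros n.
  now rewrite pow1, Rmult_1_r.
Qed.

(** In [central (S m) ^ 2] the factor 2m+1 occurs squared; the denominator 2(m+1)-1 cancels one
    copy. The sign is the one left out of [lhs_tail]. *)
Lemma lhs_tail_coef (t : R) (m : nat) :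
  lhs_tail t m = - (lhs_coef (S m) * (t ^ 2) ^ S m).
Proof.
unfold lhs_tail, lhs_coef; rewrite <- pow_mult, central_prod.
change (odd_prod (S m)) with (odd_prod m * (2 * INR m + 1)).
rewrite S_INR; generalize (pos_INR m) (even_prod_pos (S m)); intros.
field; lra.
Qed.

Lemma rhs_tail_coef (x : R) (n : nat) :
  rhs_tail x n = rhs_coef (S n) * x ^ S n.
Proof.
unfold rhs_tail, rhs_coef; rewrite central_prod.
change (odd_prod (S n)) with (odd_prod n * (2 * INR n + 1)).
rewrite S_INR; generalize (pos_INR n) (even_prod_pos (S n)); intros.
field; lra.
Qed.

Lemma lhs_term_coef (t : R) (m : nat) :
  lhs_term t m = lhs_coef m * (t ^ 2) ^ m.
Proof. unfold lhs_term, lhs_coef; now rewrite pow_mult. Qed.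

Lemma rhs_term_coef (x : R) (n : nat) :
  rhs_term x n = rhs_coef n * x ^ n.
Proof.
unfold rhs_term, rhs_coef.
assert (h : powerRZ (- 1) (Z.of_nat n - 1) ^ 2 = 1).
(* At n = 0 the exponent is -1, not a natural number, so the sign is computed directly. *)
{ destruct n as [|n]; [simpl; field|].
  replace (Z.of_nat (S n) - 1)%Z with (Z.of_nat n) by lia.
  rewrite <- pow_powerRZ, <- pow_mult, Nat.mul_comm; apply pow_1_even. }
generalize (two_n_minus_1_neq_0 n); intros hn.
transitivity (powerRZ (- 1) (Z.of_nat n - 1) ^ 2
  * (central n / (2 * INR n - 1)) ^ 2 * x ^ n); [field; exact hn|].
rewrite h; ring.
Qed.

Theorem theorem1 (x : R) (hx : 0 <= x <= 1) :
  let t := 2 * root4 x / (1 + sqrt x) in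
  (ex_series (lhs_tail t) /\ ex_series (rhs_tail x) /\
   (1 + sqrt x) * (1 - Series (lhs_tail t)) = 1 + Series (rhs_tail x)) /\
  (ex_series (lhs_term t) /\ ex_series (rhs_term x) /\
   (1 + sqrt x) * Series (lhs_term t) = Series (rhs_term x)).
Proof.
intros t.
assert (hk : 0 <= sqrt x <= 1).
{ split; [apply sqrt_pos|rewrite <- sqrt_1; now apply sqrt_le_1_alt]. }
assert (ht : t ^ 2 = landen (sqrt x)).
(* The numerator's [sqrt x] becomes the square of the fourth root. *)
{ unfold landen; rewrite <- (pow2_sqrt (sqrt x)) at 1 by apply hk.
  unfold t, root4; field; lra. }
assert (ht1 : 0 <= t ^ 2 <= 1).
{ split; [apply pow2_ge_0|].
  rewrite ht, landen_compl by apply hk.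
  generalize (pow2_ge_0 ((1 - sqrt x) / (1 + sqrt x))); lra. }
assert (el := ex_series_unit_interval _ _ lhs_coef_abs_summable ht1).
assert (er := ex_series_unit_interval _ _ rhs_coef_abs_summable hx).
assert (E : (1 + sqrt x) * Series (fun n => lhs_coef n * (t ^ 2) ^ n)
  = Series (fun n => rhs_coef n * x ^ n)).
{ generalize (landen_identity (sqrt x) hk).
  now rewrite <- ht, pow2_sqrt by apply hx. }
split; split; [| split | |split].
- apply (ex_series_ext (fun n => - (lhs_coef (S n) * (t ^ 2) ^ S n))).
  + intros n; symmetry; apply lhs_tail_coef.
  + apply (ex_series_opp (fun n => lhs_coef (S n) * (t ^ 2) ^ S n)).
    now apply (ex_series_incr_1 (fun n => lhs_coef n * (t ^ 2) ^ n)).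
- apply (ex_series_ext (fun n => rhs_coef (S n) * x ^ S n)).
  + intros n; symmetry; apply rhs_tail_coef.
  + now apply (ex_series_incr_1 (fun n => rhs_coef n * x ^ n)).
- rewrite (Series_ext _ _ (lhs_tail_coef t)), (Series_ext _ _ (rhs_tail_coef x)).
  rewrite Series_opp.
  (* Splitting off the terms of index 0, both equal to 1, leaves the tails. *)
  rewrite (Series_incr_1 _ el), (Series_incr_1 _ er) in E.
  replace (lhs_coef 0) with 1 in E
    by (unfold lhs_coef; rewrite central_0; simpl; field).
  replace (rhs_coef 0) with 1 in E
    by (unfold rhs_coef; rewrite central_0; simpl; field).
  rewrite !pow_O in E; lra.
- revert el; apply ex_series_ext; intros n; symmetry; apply lhs_term_coef.
- revert er; apply ex_series_ext; intros n; symmetry; apply rhs_term_coef.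
- now rewrite (Series_ext _ _ (lhs_term_coef t)), (Series_ext _ _ (rhs_term_coef x)).
Qed.
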